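(* Let $k\ge 2$ be an integer, and let $w=w(x)$ be the unique formal power series solution of $w=x\,e^{w^{k-1}}$. Then, with $w_1=w(x_1)$, $$\left(x_1\frac{d}{d x_1}\right)^{2}P_k^{(1)}(x_1)=S_k^{(1)}(w_1)\; x_1\frac{d w_1}{d x_1},\qquad\text{where } S_k^{(1)}(w_1)=1 .$$
   Context: For a partition $\alpha\vdash n$ let $l(\alpha)$ be its number of parts and let $\mathcal C_\alpha$ be the conjugacy class of the symmetric group $\mathfrak S_n$ consisting of the permutations with cycle type $\alpha$. An ordered factorisation of $\pi\in\mathfrak S_n$ into $k$-cycles is a tuple $(\sigma_1,\dots,\sigma_j)$ of $k$-cycles in $\mathfrak S_n$ (permutations of cycle type $[k,1^{n-k}]$) with $\sigma_1\cdots\sigma_j=\pi$; it is transitive if the subgroup generated by $\sigma_1,\dots,\sigma_j$ acts transitively on $\{1,\dots,n\}$. A transitive ordered factorisation of $\pi\in\mathcal C_\alpha$ into $k$-cycles is called minimal if $j=\mu_k(\alpha)$, where $$\mu_k(\alpha)=\frac{n+l(\alpha)-2}{k-1}.$$ For $\alpha\vdash n$ with $(k-1)\mid n+l(\alpha)-2$, $c_k(\alpha)$ denotes the number of minimal transitive ordered factorisations into $k$-cycles of an arbitrary but fixed $\pi\in\mathcal C_\alpha$ (this is $0$ if none exist; for $n=1$ the empty factorisation is counted, so $c_k([1])=1$). Let $u,z,p_1,p_2,\dots$ be indeterminates, $p_\alpha=p_{\alpha_1}p_{\alpha_2}\cdots$, and for $m\ge1$ let $$F_k^{(m)}=\sum_{\substack{n\ge1\\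 (k-1)\mid n+m-2}}\ \sum_{\substack{\alpha\vdash n\\ l(\alpha)=m}} c_k(\alpha)\,|\mathcal C_\alpha|\,p_\alpha\,\frac{u^{\mu_k(\alpha)}}{\mu_k(\alpha)!}\,\frac{z^n}{n!}.$$ Let $\psi_m$ be the linear operator with $\psi_m(p_\alpha u^iz^j)=\sum_{\sigma\in\mathfrak S_m}x_1^{\alpha_{\sigma(1)}}\cdots x_m^{\alpha_{\sigma(m)}}$ for partitions $\alpha$ with $m$ parts, and set $P_k^{(m)}(x_1,\dots,x_m)=\psi_m(F_k^{(m)})$, a formal power series with rational coefficients. In general $S_k^{(m)}$ denotes the symmetric function of $w_1,\dots,w_m$, $w_i=w(x_i)$, for which $\left(\sum_{i=1}^m x_i\frac{\partial}{\partial x_i}\right)^{3-m}P_k^{(m)}=S_k^{(m)}(w_1,\dots,w_m)\prod_{i=1}^m x_i\frac{dw_i}{dx_i}$. *)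

(* Defs.v *)
From mathcomp Require Import all_boot all_order all_algebra all_fingroup.
From mathcomp Require classical_sets.
From mathcomp Require Import fsbigop.

Set Implicit Arguments.
Unset Strict Implicit.
Unset Printing Implicit Defensive.

Import GRing.Theory.
Local Open Scope nat_scope.

(* A partition is the weakly decreasing list of its positive parts, so that
   n is [sumn al] and l(al) is [size al]. *)
Definition is_partition (al : seq nat) : bool :=
  sorted geq al && all (leq 1) al.

Definition cycle_type (n : nat) (s : 'S_n) : seq nat :=
  sort geq [seq #|pred_of_set B| | B <- enum (porbits s)].

Definition conj_class (n : nat) (al : seq nat) : {set 'S_n} :=
  [set s : 'S_n | cycle_type s == al].

(* For k > n the list below does not sum to n, so no permutation qualifies. *)
Definition is_kcycle (n k : nat) (s : 'S_n) : bool :=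
  cycle_type s == k :: nseq (n - k) 1.

(* MathComp composes permutations from left to right; under the opposite
   convention one gets the same number of factorisations, reversing tuples. *)
Definition transitive_factorisation (n k j : nat) (p : 'S_n)
    (t : j.-tuple 'S_n) : bool :=
  [&& all (@is_kcycle n k) t,
      (\prod_(s <- t) s)%g == p &
      [transitive <<[set s in t]>>%g, on [set: 'I_n] | 'P]].

Definition muk (k : nat) (al : seq nat) : nat :=
  (sumn al + size al - 2) %/ (k - 1).

Definition num_min_fact (n k : nat) (al : seq nat) (p : 'S_n) : nat :=
  #|[set t : (muk k al).-tuple 'S_n | transitive_factorisation k p t]|.

(* [pick] fixes an arbitrary permutation of cycle type al. *)
Definition ck (k : nat) (al : seq nat) : nat :=
  if [pick p in conj_class (sumn al) al] is Some p
  then num_min_fact k al p else 0.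

Local Open Scope ring_scope.

(* (al, i, j) stands for the monomial p_al u^i z^j. *)
Definition monomial : Type := (seq nat * nat * nat)%type.

(* F_k^(m), given by its coefficients. *)
Definition Fk (k m : nat) (t : monomial) : rat :=
  let: (al, i, j) := t in
  if [&& is_partition al, size al == m, sumn al == j, (1 <= j)%N,
         (k - 1 %| j + m - 2)%N & i == muk k al]
  then (ck k al)%:R * #|conj_class j al|%:R / (i`!)%:R / (j`!)%:R
  else 0.

(* Coefficient of x_1^(a_1) ... x_m^(a_m) in psi_m (p_al u^i z^j), where al
   has m parts. *)
Definition psi_monomial (m : nat) (t : monomial) (a : m.-tuple nat) : rat :=
  \sum_(s : 'S_m) (a == [tuple nth 0%N t.1.1 (s i) | i < m])%:R.

(* The sum is the finitely supported one; only series supported on partitions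
   with m parts are meant as arguments. *)
Definition psi (m : nat) (G : monomial -> rat) (a : m.-tuple nat) : rat :=
  \sum_(t \in @classical_sets.setT monomial) G t * psi_monomial t a.

Definition Pk (k m : nat) : m.-tuple nat -> rat := psi (Fk k m).

(* Formal power series in one variable over the rationals; all operations are
   named, because [nat -> rat] may also carry pointwise ring operations. *)
Definition fps : Type := nat -> rat.

Definition fps_one : fps := fun n => (n == 0%N)%:R.
Definition fps_X : fps := fun n => (n == 1%N)%:R.
Definition fps_mul (f g : fps) : fps :=
  fun n => \sum_(i < n.+1) f i * g (n - i)%N.
Definition fps_pow (f : fps) (j : nat) : fps := iter j (fps_mul f) fps_one.
Definition fps_deriv (f : fps) : fps := fun n => f n.+1 *+ n.+1.

(* Composition f(g), meaningful when g has zero constant term: then g^j does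
   not contribute to the coefficient of x^n for j > n. *)
Definition fps_comp (f g : fps) : fps :=
  fun n => \sum_(j < n.+1) f j * fps_pow g j n.

Definition fps_exp (g : fps) : fps := fps_comp (fun j => (j`!)%:R^-1) g.

(* The operator x d/dx. *)
Definition euler (f : fps) : fps := fps_mul fps_X (fps_deriv f).

(* w = x e^(w^(k-1)). Any solution has zero constant term, because of the
   factor x, so for k >= 2 the exponential is the genuine one. *)
Definition is_w (k : nat) (w : fps) : Prop :=
  w = fps_mul fps_X (fps_exp (fps_pow w (k - 1))).

Definition Pk1 (k : nat) : fps := fun n => Pk k [tuple n].

(* Main.v *)
Require Import Defs.
From mathcomp Require Import all_boot all_order all_algebra all_fingroup fsbigop.
From mathcomp Require Import boolp ring zify.

(** The identity is an equality of coefficients. For n = 1 + j (k-1) the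
coefficient of x^n in P_k^(1) is c_k([n]) |C_[n]| / (j! n!), and the one in
x dw/dx is n^j / j! by Lagrange inversion; the other coefficients vanish on both
sides. So everything rests on n c_k([n]) |C_[n]| = n^j (n-1)!
([count_full_cycle]), which says that an n-cycle has n^(j-1) minimal
factorisations.

For this count, multiply the k-cycles one after the other. The identity has n
orbits and a k-cycle, being a product of k-1 transpositions, removes at most
k-1 of them. A product of j k-cycles with a single orbit therefore arises only
if each factor meets k distinct orbits and merges them. Transitivity is
automatic, as an n-cycle is transitive by itself. Weight a permutation s by
W(s), the product of its orbit sizes, that is, the number of ways to root its
orbits. If s has c orbits, the sum of W(u s) over the k-cycles u that merge k
orbits of s is n (c-1)(c-2)...(c-k+1) W(s): in terms of rooted orbits, choose
any point and then, in order, the roots of k-1 other orbits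
([sum_cycle_weight]). It is proved by writing a k-cycle as a product of
transpositions (x y_i) with a common point x and summing over the y_i one at a
time; the recursion closes once W(s) / |orbit of x| is summed along with W(s)
([sum_star_ratio], [sum_star_weight]). Over a whole tuple the factors multiply
to n^j (n-1)! ([sum_factorisation_weight]), while a full cycle has weight n.

For the series, put m = k-1 and D = x d/dx. Applying D to w = x exp(w^m) gives
D w = w + m w^m D w, hence a relation between the coefficients of degree n in
w^r and in w^(r+m) ([w_pow_rec]). As [x^n] w^n = 1 and [x^n] w^r = 0 for r > n,
it determines all of them, and so it gives both the coefficients of w
([euler_w_coef]) and its uniqueness; existence follows from x-adic contraction.
The factor S is unique because x dw/dx and w both start with x, so that
multiplication by the former and composition with the latter are injective. *)

Set Implicit Arguments.
Unset Strict Implicit.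
Unset Printing Implicit Defensive.

(** * The series w and its powers *)

Section PowerSeries.
Import Order.TTheory GRing.Theory Num.Theory.
Local Open Scope ring_scope.
Implicit Types f g h w : fps.

(** A coefficient of a Cauchy product sees only finitely many coefficients of the
factors, so commutativity and associativity are inherited from polynomials
that agree with the series far enough. *)
Lemma fps_mul_coefM f g (p q : {poly rat}) n :
    (forall i, (i <= n)%N -> p`_i = f i) ->
    (forall i, (i <= n)%N -> q`_i = g i) ->
  fps_mul f g n = (p * q)`_n.
Proof.
move=> pf qg; rewrite coefM; apply: eq_bigr => i _.
by rewrite pf ?qg ?leq_subr // -ltnS.
Qed.

Definition fps_poly f n : {poly rat} := \poly_(i < n.+1) f i.

Lemma coef_fps_poly f n i : (i <= n)%N -> (fps_poly f n)`_i = f i.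
Proof. by move=> le_in; rewrite coef_poly ltnS le_in. Qed.

Lemma fps_mulE f g n i : (i <= n)%N ->
  fps_mul f g i = (fps_poly f n * fps_poly g n)`_i.
Proof.
move=> le_in; apply: fps_mul_coefM => j le_ji;
  exact: coef_fps_poly (leq_trans le_ji le_in).
Qed.

Lemma fps_mulC f g : fps_mul f g = fps_mul g f.
Proof. by apply/funext => n; rewrite !(@fps_mulE _ _ n) // mulrC. Qed.

Lemma fps_mulA f g h : fps_mul f (fps_mul g h) = fps_mul (fps_mul f g) h.
Proof.
apply/funext => n.
rewrite (@fps_mul_coefM _ _ (fps_poly f n) (fps_poly g n * fps_poly h n)).
- rewrite (@fps_mul_coefM _ _ (fps_poly f n * fps_poly g n) (fps_poly h n)).
  + by rewrite mulrA.
  + by move=> i le_in; rewrite -fps_mulE.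
  + by move=> i; apply: coef_fps_poly.
- by move=> i; apply: coef_fps_poly.
- by move=> i le_in; rewrite -fps_mulE.
Qed.

Lemma fps_mul1 f : fps_mul fps_one f = f.
Proof.
apply/funext => n; rewrite /fps_mul big_ord_recl /= subn0 mul1r.
by rewrite big1 ?addr0 // => i _; rewrite mul0r.
Qed.

Lemma fps_mulr1 f : fps_mul f fps_one = f.
Proof. by rewrite fps_mulC fps_mul1. Qed.

Lemma fps_mulX0 f : fps_mul fps_X f 0%N = 0.
Proof. by rewrite /fps_mul big_ord1 mul0r. Qed.

Lemma fps_mulXS f n : fps_mul fps_X f n.+1 = f n.
Proof.
rewrite /fps_mul !big_ord_recl /= mul0r add0r mul1r subSS subn0.
by rewrite big1 ?addr0 // => i _; rewrite mul0r.
Qed.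

Lemma eulerE f n : euler f n = n%:R * f n.
Proof.
by case: n => [|n]; rewrite /euler ?fps_mulX0 ?mul0r // fps_mulXS mulr_natl.
Qed.

Lemma euler_mul f g n :
  euler (fps_mul f g) n = fps_mul (euler f) g n + fps_mul f (euler g) n.
Proof.
rewrite eulerE mulr_sumr -big_split; apply: eq_bigr => i _ /=.
rewrite !eulerE -[in n%:R](subnK (_ : (i <= n)%N)) -1?ltnS //.
by rewrite natrD; ring.
Qed.

Lemma fps_powS f j : fps_pow f j.+1 = fps_mul f (fps_pow f j).
Proof. by []. Qed.

Lemma fps_powD f i j : fps_pow f (i + j) = fps_mul (fps_pow f i) (fps_pow f j).
Proof.
elim: i => [|i IHi]; first by rewrite fps_mul1.
by rewrite addSn !fps_powS IHi fps_mulA.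
Qed.

Lemma fps_pow1 f : fps_pow f 1 = f.
Proof. exact: fps_mulr1. Qed.

Lemma fps_mulZr f g (a : rat) n :
  fps_mul f (fun i => a * g i) n = a * fps_mul f g n.
Proof. by rewrite /fps_mul mulr_sumr; apply: eq_bigr => i _; rewrite mulrCA. Qed.

Lemma fps_mulDr f g h n :
  fps_mul f (fun i => g i + h i) n = fps_mul f g n + fps_mul f h n.
Proof. by rewrite -big_split; apply: eq_bigr => i _; rewrite mulrDr. Qed.

Lemma euler_powS f j n :
  euler (fps_pow f j.+1) n = j.+1%:R * fps_mul (fps_pow f j) (euler f) n.
Proof.
elim: j n => [|j IHj] n; first by rewrite fps_pow1 fps_mul1 mul1r.
rewrite fps_powS euler_mul [fps_mul (euler f) _]fps_mulC.
rewrite (_ : euler (fps_pow f j.+1) = fun i => j.+1%:R * fps_mul (fps_pow f j) (euler f) i).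
  rewrite fps_mulZr (fps_mulA f (fps_pow f j)) -(fps_powS f j) [j.+2%:R]mulrSr; ring.
exact/funext.
Qed.

Lemma fps_pow_eq0 f j n : f 0%N = 0 -> (n < j)%N -> fps_pow f j n = 0.
Proof.
move=> f0; elim: j n => // j IHj n lt_nj.
rewrite fps_powS /fps_mul big_ord_recl f0 mul0r add0r big1 // => i _.
rewrite IHj ?mulr0 //= /bump /=; case: n lt_nj i => [|n] lt_nj [i Hi] //=.
by rewrite add1n subSS (leq_ltn_trans (leq_subr _ _)).
Qed.

Lemma fps_pow_diag f n : f 0%N = 0 -> f 1%N = 1 -> fps_pow f n n = 1.
Proof.
move=> f0 f1; elim: n => // n IHn.
rewrite fps_powS /fps_mul 2!big_ord_recl f0 mul0r add0r f1 mul1r subSS subn0 IHn.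
rewrite big1 ?addr0 // => i _; rewrite fps_pow_eq0 ?mulr0 //= /bump /= !add1n.
by case: n i {IHn} => [[]|n i] //; rewrite !subSS ltnS leq_subr.
Qed.

Lemma fps_comp_wide f g n N : g 0%N = 0 -> (n < N)%N ->
  fps_comp f g n = \sum_(j < N) f j * fps_pow g j n.
Proof.
move=> g0 ltnN; rewrite /fps_comp (big_ord_widen N (fun j => f j * fps_pow g j n)) //.
rewrite [RHS](bigID (fun j : 'I_N => (j < n.+1)%N)) /= [X in _ = _ + X]big1 ?addr0 //.
by move=> j; rewrite -leqNgt => lt_nj; rewrite fps_pow_eq0 // mulr0.
Qed.

Lemma fps_mul_sumr f (g : nat -> fps) N n :
  fps_mul f (fun i => \sum_(j < N) g j i) n = \sum_(j < N) fps_mul f (g j) n.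
Proof. by rewrite exchange_big; apply: eq_bigr => i _; rewrite mulr_sumr. Qed.

Lemma eq_fps_mul f g1 g2 n : (forall i, (i <= n)%N -> g1 i = g2 i) ->
  fps_mul f g1 n = fps_mul f g2 n.
Proof. by move=> eq_g; apply: eq_bigr => i _; rewrite eq_g ?leq_subr. Qed.

(** The chain rule for the exponential. At a fixed degree the composition is a
finite sum of powers of g, since g has no constant term, and it is
differentiated term by term. *)
Lemma euler_exp g : g 0%N = 0 -> euler (fps_exp g) = fps_mul (euler g) (fps_exp g).
Proof.
move=> g0; apply/funext => n.
pose E N : fps := fun i => \sum_(j < N) (j`!)%:R^-1 * fps_pow g j i.
rewrite (eq_fps_mul (g2 := E n.+1) (euler g)); last first.
  by move=> i le_in; rewrite /fps_exp (@fps_comp_wide _ _ _ n.+1).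
rewrite (fps_mul_sumr _ (fun j i => (j`!)%:R^-1 * fps_pow g j i)).
rewrite eulerE /fps_exp (@fps_comp_wide _ _ _ n.+2) // mulr_sumr big_ord_recl.
have -> : n%:R * ((0`!)%:R^-1 * fps_pow g 0 n) = 0 :> rat.
  by case: n => [|n]; rewrite ?mul0r //= !mulr0.
rewrite add0r; apply: eq_bigr => j _.
rewrite lift0 mulrCA -eulerE euler_powS fps_mulZr.
rewrite [fps_mul (euler g) _]fps_mulC mulrA factS natrM; congr (_ * _).
have j1_neq0 : j.+1%:R != 0 :> rat by rewrite pnatr_eq0.
by rewrite invfM mulrAC mulVf ?mul1r.
Qed.

Lemma is_w_coef0 k w : is_w k w -> w 0%N = 0.
Proof. by move->; rewrite fps_mulX0. Qed.

Lemma fps_pow0 f j : f 0%N = 0 -> (0 < j)%N -> fps_pow f j 0%N = 0.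
Proof. by move=> f0 j_gt0; apply: fps_pow_eq0. Qed.

Lemma is_w_coef1 k w : is_w k w -> w 1%N = 1.
Proof.
move->; rewrite fps_mulXS /fps_exp /fps_comp big_ord1.
by rewrite (_ : fps_pow _ _ _ = 1) // fact0 invr1 mulr1.
Qed.

(** With D = x d/dx, applying D to w = x exp(w^(m+1)) gives
D w = w + w D(w^(m+1)), and w D(w^(m+1)) = (m+1) w^(m+1) D w. *)
Lemma euler_w m w n : is_w m.+2 w ->
  euler w n = w n + m.+1%:R * fps_mul (fps_pow w m.+1) (euler w) n.
Proof.
move=> Hw; have w0 := is_w_coef0 Hw.
set E := fps_exp (fps_pow w m.+1).
have wE : w = fps_mul fps_X E by rewrite {1}Hw subn1.
have eulerX : euler fps_X = fps_X.
  by apply/funext => -[|[|i]]; rewrite eulerE ?mul0r ?mul1r ?mulr0.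
rewrite {1}wE euler_mul eulerX -wE; congr (_ + _).
rewrite euler_exp ?fps_pow0 // [fps_mul _ E]fps_mulC fps_mulA -wE.
rewrite (_ : euler _ = fun i => m.+1%:R * fps_mul (fps_pow w m) (euler w) i).
  by rewrite fps_mulZr (fps_mulA w) -fps_powS.
by apply/funext => i; rewrite euler_powS.
Qed.

(** Multiplying [euler_w] by (r+1) w^r turns it into a linear relation between
D(w^(r+1)), w^(r+1) and D(w^(r+m+2)). Read at degree n, it determines the
coefficient of w^(r+1) from that of the higher power w^(r+m+2). *)
Lemma w_pow_rec m w r n : is_w m.+2 w ->
  n%:R * fps_pow w r.+1 n =
    r.+1%:R * fps_pow w r.+1 n +
    r.+1%:R * m.+1%:R / (r.+1 + m.+1)%:R * (n%:R * fps_pow w (r.+1 + m.+1) n).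
Proof.
move=> Hw; have nz : (r.+1 + m.+1)%:R != 0 :> rat by rewrite pnatr_eq0.
have euler_wE : euler w =
    fun i => w i + m.+1%:R * fps_mul (fps_pow w m.+1) (euler w) i.
  by apply/funext => i; apply: euler_w.
rewrite -!eulerE addSn !euler_powS -addSn.
rewrite {1}euler_wE fps_mulDr fps_mulZr fps_mulA -fps_powD.
rewrite [fps_mul _ w]fps_mulC -fps_powS.
rewrite mulrDr; congr (_ + _).
by rewrite !mulrA divfK.
Qed.

(** Lagrange inversion for w: n [x^n] w^r = r [y^(n-r)] exp(n y^(m+1)). The
recursion [w_pow_rec] raises the exponent until it reaches n, where the
coefficient is 1. *)
Lemma w_pow_coef m w r i : is_w m.+2 w ->
  (r.+1 + i * m.+1)%:R * fps_pow w r.+1 (r.+1 + i * m.+1)%N =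
    r.+1%:R * (r.+1 + i * m.+1)%:R ^+ i / (i`!)%:R.
Proof.
move=> Hw; elim: i r => [|i IHi] r.
  rewrite mul0n addn0 fps_pow_diag ?(is_w_coef0 Hw) ?(is_w_coef1 Hw) //.
  by rewrite expr0 fact0 invr1 !mulr1.
have := IHi (r + m.+1)%N; rewrite -addSn -addnA -mulSn.
set n := (_ + _)%N => IH.
have := w_pow_rec r n Hw; rewrite {}IH => /eqP.
rewrite addrC -subr_eq -mulrBl -natrB ?leq_addr // addKn => /eqP.
have nz1 : (r.+1 + m.+1)%:R != 0 :> rat by rewrite pnatr_eq0.
have nz2 : m.+1%:R != 0 :> rat by rewrite pnatr_eq0.
have nz3 : i.+1%:R != 0 :> rat by rewrite pnatr_eq0.
have nz4 : i`!%:R != 0 :> rat by rewrite pnatr_eq0 -lt0n fact_gt0.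
rewrite natrM => E; have := congr1 (fun a => a / (i.+1%:R * m.+1%:R)) E.
rewrite [LHS]mulrAC divff ?mulf_neq0 // mul1r => ->.
rewrite factS natrM exprS; move: nz1 nz2 nz3 nz4.
move: (n%:R) (r.+1 + m.+1)%:R r.+1%:R m.+1%:R i.+1%:R => x c a b d.
by move=> *; field; do ?[apply/andP; split].
Qed.

(** In the other degrees the exponent in [w_pow_rec] jumps over n, and a power of
w beyond n has no term of degree n. *)
Lemma w_pow_coef_eq0 m w r n : is_w m.+2 w ->
  ~~ ((r < n)%N && (m.+1 %| n - r.+1)%N) -> fps_pow w r.+1 n = 0.
Proof.
move=> Hw; have w0 := is_w_coef0 Hw.
have [d le_d] : {d | n - r <= d}%N by exists (n - r)%N.
elim: d r le_d => [|d IHd] r.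
  by rewrite leqn0 subn_eq0 => le_nr _; rewrite fps_pow_eq0.
move=> le_d; case: ltnP => [lt_rn /= ndiv | le_nr _]; last exact: fps_pow_eq0.
have := w_pow_rec r n Hw; rewrite addSn (IHd (r + m.+1)%N).
- rewrite !mulr0 addr0 => /eqP; rewrite -subr_eq0 -mulrBl mulf_eq0.
  rewrite subr_eq0 eqr_nat => /orP[/eqP eq_nr | /eqP //].
  by rewrite eq_nr subnn dvdn0 in ndiv.
- rewrite addnS subnS subnDA; apply: leq_trans (_ : (n - r).-1 <= d)%N.
    by rewrite -!subn1 leq_sub2r // leq_subr.
  by rewrite -subn1 leq_subLR add1n.
apply: contra ndiv => /andP[lt_rmn].
by rewrite -addSn subnDA dvdn_subl // leq_subRL.
Qed.

Lemma euler_w_coef m w n : is_w m.+2 w ->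
  euler w n = if (0 < n)%N && (m.+1 %| n.-1)%N
              then n%:R ^+ (n.-1 %/ m.+1) / ((n.-1 %/ m.+1)`!)%:R else 0.
Proof.
move=> Hw; rewrite eulerE -{1}(fps_pow1 w).
case: ifPn => [|ndiv]; last first.
  by rewrite (w_pow_coef_eq0 Hw) ?mulr0 // subn1.
case: n => // n /=; case/dvdnP=> i ->; rewrite mulnK //.
by have := w_pow_coef 0 i Hw; rewrite mul1r.
Qed.

Lemma is_w_unique m w1 w2 : is_w m.+2 w1 -> is_w m.+2 w2 -> w1 = w2.
Proof.
move=> Hw1 Hw2; apply/funext => -[|n].
  by rewrite (is_w_coef0 Hw1) (is_w_coef0 Hw2).
have := euler_w_coef n.+1 Hw1; rewrite -(euler_w_coef n.+1 Hw2) !eulerE.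
by apply/mulfI; rewrite pnatr_eq0.
Qed.

(** Congruence modulo x^n. *)
Definition fps_agree n f g := forall i, (i < n)%N -> f i = g i.

Lemma fps_agree_mul n f1 f2 g1 g2 : fps_agree n f1 f2 -> fps_agree n g1 g2 ->
  fps_agree n (fps_mul f1 g1) (fps_mul f2 g2).
Proof.
move=> Hf Hg i lt_in; apply: eq_bigr => j _; rewrite Hf ?Hg //.
  exact: leq_ltn_trans (leq_subr _ _) lt_in.
exact: leq_ltn_trans (leq_ord j) lt_in.
Qed.

Lemma fps_agree_pow n f g j : fps_agree n f g ->
  fps_agree n (fps_pow f j) (fps_pow g j).
Proof. by move=> Hfg; elim: j => // j IHj; apply: fps_agree_mul. Qed.

Lemma fps_agree_exp n f g : fps_agree n f g ->
  fps_agree n (fps_exp f) (fps_exp g).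
Proof.
move=> Hfg i lt_in; apply: eq_bigr => j _; congr (_ * _).
exact: fps_agree_pow Hfg _ lt_in.
Qed.

Definition w_step k f := fps_mul fps_X (fps_exp (fps_pow f (k - 1))).

(** The fixed-point operator of the equation for w is a contraction for the x-adic
distance: the factor x gains one degree. *)
Lemma fps_agree_w_step n k f g : fps_agree n f g ->
  fps_agree n.+1 (w_step k f) (w_step k g).
Proof.
move=> Hfg [|i] lt_in; rewrite /w_step ?fps_mulX0 // !fps_mulXS.
exact: fps_agree_exp (fps_agree_pow _ Hfg) _ lt_in.
Qed.

(** The diagonal of the iterates of the contraction is its fixed point. *)
Lemma is_w_exists k : exists w, is_w k w.
Proof.
pose u n := iter n (w_step k) fps_X.
have u_agree n d : fps_agree n (u n) (u (n + d)%N).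
  by elim: n => // n IHn; apply: fps_agree_w_step.
exists (fun n => u n.+1 n); apply/funext => n.
have -> : u n.+1 n = u n.+2 n by rewrite -(addn1 n.+1) (u_agree n.+1 1%N).
apply: (@fps_agree_w_step n.+1) => // i lt_in.
by rewrite (u_agree i.+1 (n - i)%N) // addSn subnKC.
Qed.

(** The first coefficient where f and g could differ appears, multiplied by 1, one
degree higher in the product. *)
Lemma fps_mul_order1_inj f g h : h 0%N = 0 -> h 1%N = 1 ->
  fps_mul f h = fps_mul g h -> f = g.
Proof.
move=> h0 h1 eq_fg; apply/funext => n; elim/ltn_ind: n => n IHn.
have /(congr1 (fun f => f n.+1)) := eq_fg.
rewrite /fps_mul !big_ord_recr /= subSnn subnn h0 h1 !mulr0 !mulr1 !addr0.
by under eq_bigr => i _ do rewrite IHn //; move/addrI.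
Qed.

(** Since h^n = x^n + ..., the first coefficient where f and g could differ appears
in the composition at the same degree. *)
Lemma fps_comp_order1_inj f g h : h 0%N = 0 -> h 1%N = 1 ->
  fps_comp f h = fps_comp g h -> f = g.
Proof.
move=> h0 h1 eq_fg; apply/funext => n; elim/ltn_ind: n => n IHn.
have /(congr1 (fun f => f n)) := eq_fg.
rewrite /fps_comp !big_ord_recr /= fps_pow_diag // !mulr1.
by under eq_bigr => i _ do rewrite IHn //; move/addrI.
Qed.

Lemma fps_comp_one f : fps_comp fps_one f = fps_one.
Proof.
apply/funext => n; rewrite /fps_comp big_ord_recl /= mul1r.
by rewrite big1 ?addr0 // => i _; rewrite mul0r.
Qed.

End PowerSeries.

(** * Merging two orbits by a transposition *)

Section OrbitWeight.
Import Order.TTheory GRing.Theory Num.Theory.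
Local Open Scope ring_scope.
Variable T : finType.
Implicit Types (s t : {perm T}) (x y z : T).

Lemma porbit_closed s (A : {set T}) x :
  (forall z, z \in A -> s z \in A) -> x \in A -> porbit s x \subset A.
Proof.
move=> sA xA; apply/subsetP => _ /porbitP[i ->].
by elim: i => [|i IHi]; rewrite ?perm1 // expgSr permM sA.
Qed.

Lemma porbit_perm1 s x : porbit s (s x) = porbit s x.
Proof. by have := porbit_perm s 1 x; rewrite expg1. Qed.

Lemma mem_porbit_perm s x z : (s z \in porbit s x) = (z \in porbit s x).
Proof. by rewrite -!eq_porbit_mem porbit_perm1. Qed.

Lemma porbit_disj s x y z : z \in porbit s x -> z \in porbit s y ->
  porbit s x = porbit s y.
Proof. by rewrite -!eq_porbit_mem => /eqP <- /eqP. Qed.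

Section Merge.
Variables (s : {perm T}) (x y : T).
Hypothesis nxy : y \notin porbit s x.
Let t : {perm T} := (tperm x y * s)%g.

Lemma merge_out z : z != x -> z != y -> t z = s z.
Proof. by move=> zx zy; rewrite permM tpermD // eq_sym. Qed.

(** The permutation [tperm x y * s] sends x to s y and then follows s along the
orbit of y, up to y itself. *)
Lemma porbit_merge_sub : porbit s y \subset porbit t x.
Proof.
have tx : t x = s y by rewrite permM tpermL.
apply/subsetP => _ /porbitP[i ->].
have yS : s y \in porbit t x by rewrite -tx mem_porbit_perm porbit_id.
suff sub j : (s ^+ j.+1)%g y \in porbit t x.
  case: i => [|i] //; have := sub #|porbit s y|.-1.
  rewrite prednK ?lt0n ?card_porbit_neq0 // permX iter_porbit.
  by rewrite perm1.
elim: j => [|j IHj]; first by rewrite expg1.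
rewrite expgSr permM; set z := (s ^+ j.+1)%g y in IHj *.
have [-> // | zy] := eqVneq z y.
rewrite -merge_out ?mem_porbit_perm //.
apply: contraNneq nxy => <-; rewrite porbit_sym; exact: mem_porbit.
Qed.
End Merge.

Lemma porbit_merge s x y : y \notin porbit s x ->
  porbit (tperm x y * s)%g x = porbit s x :|: porbit s y.
Proof.
move=> nxy; set t := (_ * _)%g; have yx : y \in porbit t x.
  by apply: (subsetP (porbit_merge_sub nxy)); apply: porbit_id.
have xy : porbit t y = porbit t x by apply/eqP; rewrite eq_porbit_mem.
apply/eqP; rewrite eqEsubset subUset porbit_merge_sub // andbT.
rewrite -{2}xy /t {2}tpermC porbit_merge_sub 1?porbit_sym // andbT.
apply: porbit_closed; last by rewrite inE porbit_id.
move=> z; rewrite permM !inE; case: tpermP => [->|->|_ _].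
- by rewrite !mem_porbit_perm !porbit_id orbT.
- by rewrite !mem_porbit_perm !porbit_id.
by rewrite !mem_porbit_perm.
Qed.

Lemma porbit_merge_out s x y z :
    z \notin porbit s x -> z \notin porbit s y ->
  porbit (tperm x y * s)%g z = porbit s z.
Proof.
move=> zx zy; apply/setP => a.
have Ei i : ((tperm x y * s) ^+ i)%g z = (s ^+ i)%g z.
  elim: i => // i IHi; rewrite !expgSr [LHS]permM [RHS]permM IHi merge_out //.
    by apply: contraNneq zx => <-; rewrite porbit_sym mem_porbit.
  by apply: contraNneq zy => <-; rewrite porbit_sym mem_porbit.
by apply/porbitP/porbitP => -[i ->]; exists i; rewrite Ei.
Qed.

(** A transposition that meets two orbits of s replaces them by their union and
leaves the other orbits alone. *)
Lemma porbits_merge s x y : y \notin porbit s x ->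
  porbits (tperm x y * s)%g =
  (porbit s x :|: porbit s y) |: (porbits s :\ porbit s x :\ porbit s y).
Proof.
move=> nxy; set t := (_ * _)%g.
have xy_merge : porbit t y = porbit t x.
  by apply/eqP; rewrite eq_porbit_mem porbit_merge // inE porbit_id orbT.
have out z : z \notin porbit s x -> z \notin porbit s y ->
   porbit t z = porbit s z by apply: porbit_merge_out.
have in_ z : (z \in porbit s x) || (z \in porbit s y) -> porbit t z = porbit t x.
  by move=> zxy; apply/eqP; rewrite eq_porbit_mem porbit_merge // inE.
apply/setP => B; rewrite !inE -(porbit_merge nxy) -/t.
apply/imsetP/idP => [[z _ ->] | /orP[/eqP-> | /and3P[By Bx /imsetP[z _ Bz]]]].
- have [/in_-> | ] := boolP ((z \in porbit s x) || (z \in porbit s y)).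
    by rewrite eqxx.
  rewrite negb_or => /andP[zx zy]; rewrite out // imset_f // andbT.
  by rewrite !eq_porbit_mem zx zy orbT.
- by exists x.
- exists z => //; rewrite out //; first by rewrite -eq_porbit_mem -Bz.
  by rewrite -eq_porbit_mem -Bz.
Qed.

(** The number of ways to choose a root in every orbit. Counting permutations with
this weight makes the sums over merging transpositions close up. *)
Definition orbit_weight s : rat := \prod_(B in porbits s) #|B|%:R.

Lemma card_porbit_rat_neq0 s x : #|porbit s x|%:R != 0 :> rat.
Proof. by rewrite pnatr_eq0 card_porbit_neq0. Qed.

Lemma card_porbit_merge s x y : y \notin porbit s x ->
  #|porbit (tperm x y * s)%g x| = (#|porbit s x| + #|porbit s y|)%N.
Proof.
move=> nxy; rewrite porbit_merge // cardsU (_ : _ :&: _ = set0) ?cards0 ?subn0 //.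
apply/setP => z; rewrite !inE; apply: contraNF nxy => /andP[zx zy].
by rewrite (porbit_disj zx zy) porbit_id.
Qed.

Lemma orbit_weight_merge s x y : y \notin porbit s x ->
  orbit_weight (tperm x y * s)%g =
  (#|porbit s x| + #|porbit s y|)%:R / (#|porbit s x|%:R * #|porbit s y|%:R)
  * orbit_weight s.
Proof.
move=> nxy; rewrite /orbit_weight porbits_merge // big_setU1 /=; last first.
  rewrite !inE; apply/negP => /and3P[_ _ /imsetP[z _ Ez]].
  have xz : x \in porbit s z by rewrite -Ez inE porbit_id.
  have yz : y \in porbit s z by rewrite -Ez inE porbit_id orbT.
  by rewrite porbit_sym in xz; rewrite (porbit_disj xz (porbit_id s z)) yz in nxy.
rewrite -porbit_merge // card_porbit_merge //.
have yx : porbit s y != porbit s x by rewrite eq_porbit_mem.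
rewrite [in RHS](big_setD1 (porbit s x)) ?imset_f //=.
rewrite [in RHS](big_setD1 (porbit s y)) ?inE ?yx ?imset_f //=.
move: (card_porbit_rat_neq0 s x) (card_porbit_rat_neq0 s y) => ? ?.
by rewrite natrD; field; apply/andP.
Qed.

Lemma card_porbits_merge s x y : y \notin porbit s x ->
  (#|porbits (tperm x y * s)%g|.+1 = #|porbits s|)%N.
Proof.
move=> nxy; have := porbits_mul_tperm s x y.
rewrite /= porbit_sym nxy (_ : x != y) 1?porbit_sym ?nxy /=.
  by rewrite addn1 addn2 => -[].
by apply: contraNneq nxy => ->; apply: porbit_id.
Qed.

Lemma card_porbits_tperm_same s x y : y \in porbit s x ->
  (#|porbits s| <= #|porbits (tperm x y * s)%g|)%N.
Proof.
move=> yx; have := porbits_mul_tperm s x y.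
by rewrite /= porbit_sym yx addn0 => ->; rewrite leq_addr.
Qed.

Lemma sum_porbit_partition s (F : {set T} -> rat) :
  \sum_x F (porbit s x) = \sum_(B in porbits s) #|B|%:R * F B.
Proof.
rewrite (partition_big (porbit s) (mem (porbits s))) /=; last first.
  by move=> x _; apply: imset_f.
apply: eq_bigr => B /imsetP[z _ ->].
rewrite (eq_bigr (fun=> F (porbit s z))) => [|x /eqP-> //].
rewrite sumr_const mulr_natl; congr (_ *+ _); apply: eq_card => x.
by rewrite -[RHS]eq_porbit_mem.
Qed.

Lemma sum_card_porbits s : (\sum_(B in porbits s) #|B|)%N = #|T|.
Proof.
apply/eqP; rewrite -(eqr_nat rat) natr_sum.
rewrite (eq_bigr (fun B : {set T} => #|B|%:R * 1)%R) => [|B _]; last by rewrite mulr1.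
by rewrite -(sum_porbit_partition s (fun=> 1%R)) sumr_const.
Qed.

(** Each orbit receives the total mass 1. *)
Lemma sum_inv_card_porbit s :
  \sum_x #|porbit s x|%:R^-1 = #|porbits s|%:R :> rat.
Proof.
rewrite (sum_porbit_partition s (fun B => #|B|%:R^-1)) -sum1_card natr_sum.
by apply: eq_bigr => _ /imsetP[z _ ->]; rewrite mulfV // card_porbit_rat_neq0.
Qed.

Lemma sum_inv_card_porbit_out s x :
  \sum_(y | y \notin porbit s x) #|porbit s y|%:R^-1 = #|porbits s|%:R - 1 :> rat.
Proof.
rewrite -sum_inv_card_porbit [in RHS](bigID (fun y => y \in porbit s x)) /=.
rewrite [X in _ = X + _ - _](eq_bigr (fun=> #|porbit s x|%:R^-1)) => [|y yx].
  rewrite sumr_const -[_^-1 *+ _]mulr_natl mulfV ?card_porbit_rat_neq0 //.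
  by rewrite addrAC subrr add0r.
by rewrite -eq_porbit_mem in yx; rewrite (eqP yx).
Qed.

(** Merging the orbits C of x and C' of y divides the weight by |C| |C'| and
multiplies it by |C| + |C'|, the size of the new orbit of x. So the weight
divided by the size of the orbit of x is only divided by |C'|, and the sum over
y counts the orbits other than C. *)
Lemma sum_merge_ratio s x :
  \sum_(y | y \notin porbit s x)
     orbit_weight (tperm x y * s)%g / #|porbit (tperm x y * s)%g x|%:R =
  (#|porbits s|%:R - 1) * (orbit_weight s / #|porbit s x|%:R).
Proof.
rewrite -(sum_inv_card_porbit_out s x) mulr_suml; apply: eq_bigr => y nxy.
rewrite orbit_weight_merge // card_porbit_merge //.
move: (card_porbit_rat_neq0 s x) (card_porbit_rat_neq0 s y) => ? ?.
have : (#|porbit s x| + #|porbit s y|)%:R != 0 :> rat.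
  by rewrite pnatr_eq0 addn_eq0 negb_and card_porbit_neq0.
by rewrite natrD => ?; field; do ?[apply/andP; split].
Qed.

(** The factor (|C| + |C'|) / (|C| |C'|) is 1/|C'| + 1/|C|. The first summand counts
the orbits other than C, the second counts the points outside C. *)
Lemma sum_merge_weight s x :
  \sum_(y | y \notin porbit s x) orbit_weight (tperm x y * s)%g =
  (#|porbits s|%:R - 2) * orbit_weight s
  + #|T|%:R * (orbit_weight s / #|porbit s x|%:R).
Proof.
transitivity (\sum_(y | y \notin porbit s x)
   (#|porbit s y|%:R^-1 + #|porbit s x|%:R^-1) * orbit_weight s).
  apply: eq_bigr => y nxy; rewrite orbit_weight_merge //.
  move: (card_porbit_rat_neq0 s x) (card_porbit_rat_neq0 s y) => ? ?.
  by rewrite natrD; field; do ?[apply/andP; split].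
rewrite -mulr_suml big_split /= sum_inv_card_porbit_out sumr_const.
have : (#|[pred y | y \notin porbit s x]| + #|porbit s x| = #|T|)%N.
  by rewrite -(cardC (mem (porbit s x))) addnC; congr (_ + _)%N; apply: eq_card.
move: (card_porbit_rat_neq0 s x) => nz <-; rewrite -mulr_natr natrD.
by field.
Qed.
End OrbitWeight.

(** * Weighted sums over cycles and over products of cycles *)

Section Star.
Import Order.TTheory GRing.Theory Num.Theory.
Local Open Scope ring_scope.

Lemma big_tuple_cons (I : finType) m (P : pred (m.+1.-tuple I))
    (F : m.+1.-tuple I -> rat) :
  \sum_(t | P t) F t =
  \sum_x \sum_(l : m.-tuple I | P (cons_tuple x l)) F (cons_tuple x l).
Proof.
rewrite pair_big_dep (reindex (fun p : I * m.-tuple I => cons_tuple p.1 p.2)) //=.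
exists (fun t => (thead t, [tuple of behead t])) => [[x l]|t] _ /=.
  by congr (_, _); apply: val_inj.
by rewrite [RHS]tuple_eta; apply: val_inj.
Qed.

Variable T : finType.
Implicit Types (s t g : {perm T}) (x y z : T) (l : seq T).

(** The product of the transpositions of x with the entries of l. When x :: l has
no repetition it is the cycle x, l_0, l_1, ... (see [star_next]); as a product
of transpositions it can be applied, and summed over, one entry at a time. *)
Definition star x l : {perm T} := foldr (fun y s => tperm x y * s)%g 1%g l.

Lemma star_cons x y l s : (star x (y :: l) * s = tperm x y * (star x l * s))%g.
Proof. by rewrite mulgA. Qed.

(** A transposition changes the number of orbits by one. *)
Lemma card_porbits_star x l s :
  (#|porbits s| <= #|porbits (star x l * s)%g| + size l)%N.
Proof.
elim: l => [|y l IHl]; first by rewrite mul1g addn0.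
rewrite star_cons (leq_trans IHl) // addnS -addSn leq_add2r.
set u := (_ * s)%g; have [yu|yu] := boolP (y \in porbit u x).
  by rewrite (leq_trans (card_porbits_tperm_same yu)) // leqnSn.
by rewrite (card_porbits_merge yu).
Qed.

(** Losing one orbit per transposition is the fastest possible decrease, so a
decrease by the length of the list forces each transposition to merge. *)
Lemma card_porbits_star_cons x y l s :
  (#|porbits (star x (y :: l) * s)%g| + (size l).+1 == #|porbits s|)%N =
  (#|porbits (star x l * s)%g| + size l == #|porbits s|)%N &&
  (y \notin porbit (star x l * s)%g x).
Proof.
rewrite star_cons; have := card_porbits_star x l s; set u := (_ * s)%g.
have [yu|yu] := boolP (y \in porbit u x).
  by have := card_porbits_tperm_same yu; rewrite andbF => ? ?; apply/eqP; lia.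
by have := card_porbits_merge yu; rewrite andbT => <- _; rewrite addnS addSn.
Qed.

(** When all the transpositions merge, the orbit of x absorbs each entry, and the
next entry has to lie outside of it. *)
Lemma star_merging_uniq x l s :
  (#|porbits (star x l * s)%g| + size l == #|porbits s|)%N ->
  uniq (x :: l) /\ {subset x :: l <= porbit (star x l * s)%g x}.
Proof.
elim: l => [|y l IHl].
  by move=> _; split=> // z; rewrite inE => /eqP->; apply: porbit_id.
rewrite card_porbits_star_cons => /andP[/IHl[Ul sub] ny]; split.
  have : y \notin x :: l by apply: contra ny => /sub.
  by move: Ul; rewrite /= !inE !negb_or eq_sym => /andP[-> ->] /andP[-> ->].
move=> z zl; rewrite star_cons (porbit_merge ny) inE.
have [-> | zy] := eqVneq z y; first by rewrite porbit_id orbT.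
by rewrite sub //; move: zl; rewrite !inE (negPf zy).
Qed.

(** The falling factorial a (a-1) ... (a-m+1), over the rationals, so that its
recursion needs no case for a < m. *)
Definition falling (a : rat) m : rat := \prod_(i < m) (a - i%:R).

Lemma fallingS a m : falling a m.+1 = falling a m * (a - m%:R).
Proof. exact: big_ord_recr. Qed.

Lemma big_star_cons s x m (F : {perm T} -> rat) :
  \sum_(l : m.+1.-tuple T | (#|porbits (star x l * s)%g| + m.+1 == #|porbits s|)%N)
     F (star x l * s)%g =
  \sum_(l : m.-tuple T | (#|porbits (star x l * s)%g| + m == #|porbits s|)%N)
     \sum_(y | y \notin porbit (star x l * s)%g x) F (tperm x y * (star x l * s))%g.
Proof.
pose P l := (#|porbits (star x l * s)%g| + size l == #|porbits s|)%N.
have Pcons y (l : m.-tuple T) :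
    (#|porbits (star x (cons_tuple y l) * s)%g| + m.+1 == #|porbits s|)%N =
    P l && (y \notin porbit (star x l * s)%g x).
  by rewrite -card_porbits_star_cons size_tuple.
rewrite big_tuple_cons (exchange_big_dep (fun l : m.-tuple T => P l)) /=; last first.
  by move=> y l _; rewrite Pcons => /andP[].
apply: eq_big => [l | l Pl]; first by rewrite /P size_tuple.
by apply: eq_big => [y | y _]; rewrite ?Pcons ?Pl // -star_cons.
Qed.

(** Iterates [sum_merge_ratio]; the number of orbits drops by one at each step. *)
Lemma sum_star_ratio s m :
  \sum_x \sum_(l : m.-tuple T | (#|porbits (star x l * s)%g| + m == #|porbits s|)%N)
     orbit_weight (star x l * s)%g / #|porbit (star x l * s)%g x|%:R =
  #|porbits s|%:R * falling (#|porbits s|%:R - 1) m * orbit_weight s.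
Proof.
elim: m => [|m IHm].
  rewrite /falling big_ord0 mulr1 -sum_inv_card_porbit mulr_suml.
  apply: eq_bigr => x _; rewrite (big_pred1 [tuple]) => [|l].
    by rewrite mul1g mulrC.
  by rewrite (tuple0 l) /= mul1g addn0 eqxx.
rewrite fallingS mulrA mulrAC -{}IHm mulr_suml; apply: eq_bigr => x _.
rewrite (big_star_cons _ _ _ (fun t => orbit_weight t / #|porbit t x|%:R)).
rewrite mulr_suml; apply: eq_bigr => l /eqP <-.
by rewrite sum_merge_ratio natrD; ring.
Qed.

(** Iterating [sum_merge_weight], where [sum_star_ratio] evaluates the second term,
gives the recursion A_(m+1) = (c - m - 2) A_m + n B_m with
B_m = c (c-1) ... (c-m) W and c = #|porbits s|. Its solution is
A_m = (m+1) n (c-1) ... (c-m) W. *)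
Lemma sum_star_weight s m :
  \sum_x \sum_(l : m.-tuple T | (#|porbits (star x l * s)%g| + m == #|porbits s|)%N)
     orbit_weight (star x l * s)%g =
  m.+1%:R * #|T|%:R * falling (#|porbits s|%:R - 1) m * orbit_weight s.
Proof.
elim: m => [|m IHm].
  rewrite /falling big_ord0 mulr1 mul1r mulr_natl -sumr_const.
  apply: eq_bigr => x _; rewrite (big_pred1 [tuple]) => [|l]; first by rewrite mul1g.
  by rewrite (tuple0 l) /= mul1g addn0 eqxx.
pose c := #|porbits s|%:R : rat.
transitivity ((c - m%:R - 2) *
    (m.+1%:R * #|T|%:R * falling (c - 1) m * orbit_weight s) +
    #|T|%:R * (c * falling (c - 1) m * orbit_weight s)).
  rewrite -sum_star_ratio -IHm !mulr_sumr -big_split; apply: eq_bigr => x _ /=.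
  rewrite (big_star_cons _ _ _ (@orbit_weight T)).
  rewrite !mulr_sumr -big_split; apply: eq_bigr => l /eqP El /=.
  by rewrite sum_merge_weight /c -El natrD; ring.
by rewrite fallingS -/c -[m.+2]addn2 -[m.+1]addn1 !natrD; ring.
Qed.

(** A formulation of being a k-cycle in terms of orbits, meaningful on any finite
type; see [is_kcycleE]. *)
Definition single_cycle k s : bool :=
  [exists x, (#|porbit s x| == k) && [forall z, (z \notin porbit s x) ==> (s z == z)]].

Lemma star_next x l z : uniq (x :: l) -> star x l z = next (x :: l) z.
Proof.
elim: l z => [|y l IHl] z; first by rewrite perm1 /=; case: eqP.
rewrite /= inE negb_or => /and3P[/andP[xy xl] yl Ul].
have Uxl : uniq (x :: l) by rewrite /= xl.
have xl_y : star x l y = y.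
  by rewrite IHl // next_nth inE eq_sym (negPf xy) /= (negPf yl).
rewrite permM; case: tpermP => [->|->|/eqP zx /eqP zy].
- by rewrite xl_y eqxx.
- rewrite IHl //= eq_sym (negPf xy).
  by case: (l) yl => [|a l'] /=; rewrite ?eqxx //.
rewrite IHl //= (negPf zx).
by case: (l) => [|a l'] /=; rewrite (negPf zx) (negPf zy).
Qed.

(** A permutation that runs through x :: l cyclically determines l from x. *)
Lemma star_traject x l s : uniq (x :: l) -> s =1 next (x :: l) ->
  [/\ porbit s x =i x :: l, l = traject s (s x) (size l)
    & forall z, z \notin porbit s x -> s z = z].
Proof.
move=> Ul sE; have cyc : fcycle s (x :: l).
  by rewrite (eq_fcycle sE) cycle_next.
have El : rcons l x = traject s (s x) (size l).+1.
  case/fpathP: (cyc : fpath s x (rcons l x)) => n En.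
  by rewrite En -(size_traject s (s x) n) -En size_rcons.
have mem_ : porbit s x =i x :: l.
  move=> z; apply/idP/idP; last first.
    rewrite -mem_rcons El => /trajectP[i _ ->].
    by rewrite -iterSr -permX mem_porbit.
  have sub : porbit s x \subset [set y in x :: l].
    by apply: porbit_closed => [y|]; rewrite !in_set ?mem_head // sE mem_next.
  by move/(subsetP sub); rewrite inE.
split=> // [|z]; last by rewrite mem_ sE next_nth => /negPf->.
by move: El; rewrite trajectSr => /rcons_inj[].
Qed.

Lemma traject_star x s : (forall z, z \notin porbit s x -> s z = z) ->
  s = star x (traject s (s x) #|porbit s x|.-1).
Proof.
move=> sfix; set l := traject _ _ _.
have El : x :: l = traject s x #|porbit s x|.
  by case: #|porbit s x| (card_porbit_neq0 s x) @l => [|n] //= _.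
have Ul : uniq (x :: l) by rewrite El uniq_traject_porbit.
have cyc : fcycle s (x :: l).
  have -> : fcycle s (x :: l) = fpath s x (rcons l x) by [].
  apply/fpathP; exists #|porbit s x|.
  rewrite /l; move: (iter_porbit s x) (card_porbit_neq0 s x).
  by case: #|porbit s x| => // n; rewrite iterSr trajectSr => -> _.
apply/permP => z; rewrite star_next //.
have [zl | zl] := boolP (z \in x :: l); first by apply/eqP/(next_cycle cyc).
by rewrite sfix ?porbit_traject -?El // next_nth (negPf zl).
Qed.

Lemma single_cycle_moved k s x : (1 < k)%N -> single_cycle k s ->
  s x != x -> #|porbit s x| = k /\ (forall z, z \notin porbit s x -> s z = z).
Proof.
move=> k1 /existsP[a /andP[/eqP ka /forallP sa]] sx.
have xa : x \in porbit s a.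
  by apply: contraNT sx => xa; have := sa x; rewrite xa.
rewrite -eq_porbit_mem in xa; rewrite (eqP xa); split=> // z za.
by apply/eqP; have := sa z; rewrite za.
Qed.

Lemma card_single_cycle_moved k s : (1 < k)%N -> single_cycle k s ->
  #|[set x | s x != x]| = k.
Proof.
move=> k1 /existsP[a /andP[/eqP ka /forallP sa]].
rewrite -ka; apply: eq_card => z; rewrite in_set.
apply/idP/idP => [|za]; first by apply: contraNT => za; have := sa z; rewrite za.
apply: contraTneq k1 => sz; rewrite -ka -leqNgt -(cards1 z).
rewrite -eq_porbit_mem in za; rewrite -(eqP za) subset_leq_card //.
by apply: porbit_closed => [y|]; rewrite !inE // => /eqP->; rewrite sz.
Qed.

Lemma star_single_cycle x l : uniq (x :: l) -> single_cycle (size l).+1 (star x l).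
Proof.
move=> Ul; have [mem_ _ sfix] := star_traject Ul (fun z => star_next z Ul).
apply/existsP; exists x; rewrite (eq_card mem_) (card_uniqP Ul) eqxx /=.
by apply/forallP => z; apply/implyP => /sfix->.
Qed.

(** A cycle of length m+1 is written as a star in m+1 ways, once for each choice of
the first point in its support. *)
Lemma sum_single_cycle m (F : {perm T} -> rat) : (0 < m)%N ->
  m.+1%:R * \sum_(s | single_cycle m.+1 s) F s =
  \sum_x \sum_(l : m.-tuple T | uniq (x :: l)) F (star x l).
Proof.
move=> m0; transitivity (\sum_(s | single_cycle m.+1 s) \sum_(x | s x != x) F s).
  rewrite mulr_sumr; apply: eq_bigr => s cs.
  rewrite sumr_const -(card_single_cycle_moved _ cs) // mulr_natl.
  by congr (_ *+ _); apply: eq_card => x; rewrite in_set.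
rewrite (exchange_big_dep predT) //=; apply: eq_bigr => x _.
(* For a fixed x, the cycles that move x correspond to the lists l. *)
pose h' s : m.-tuple T := Tuple (introT eqP (size_traject s (s x) m)).
rewrite (reindex_onto (fun l : m.-tuple T => star x l) h') /=; last first.
  move=> s /andP[cs sx]; have [Es sfix] := single_cycle_moved (m0 : 1 < m.+1)%N cs sx.
  by rewrite [RHS](traject_star sfix) Es.
apply: eq_bigl => l; apply/idP/idP => [/andP[/andP[cs sx] /eqP El] | Ul].
  have [Es sfix] := single_cycle_moved (m0 : 1 < m.+1)%N cs sx.
  have := uniq_traject_porbit (star x l) x.
  by move/(congr1 val): El; rewrite Es /= => ->.
have [mem_ El sfix] := star_traject Ul (fun z => star_next z Ul).
rewrite -{1}(size_tuple l) star_single_cycle //=; apply/andP; split.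
  rewrite star_next //; case: l Ul {mem_ El sfix} => -[|a l] sz /=.
    by move: m0; rewrite -(eqP sz).
  by case/andP; rewrite inE negb_or eqxx eq_sym => /andP[].
by apply/eqP/val_inj; rewrite /= [RHS]El size_tuple.
Qed.

(** The m+1 ways to write a cycle cancel the factor m+1 of [sum_star_weight]. *)
Lemma sum_cycle_weight s m : (0 < m)%N ->
  \sum_(c | single_cycle m.+1 c && (#|porbits (c * s)%g| + m == #|porbits s|)%N)
     orbit_weight (c * s)%g =
  #|T|%:R * falling (#|porbits s|%:R - 1) m * orbit_weight s.
Proof.
move=> m0; have nz : m.+1%:R != 0 :> rat by rewrite pnatr_eq0.
apply: (mulfI nz); rewrite !mulrA -sum_star_weight big_mkcondr.
rewrite sum_single_cycle //; apply: eq_bigr => x _.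
rewrite -big_mkcondr; apply: eq_bigl => l.
apply/andP/idP => [[]// | El]; split=> //.
by have [] := @star_merging_uniq x l s; rewrite ?size_tuple.
Qed.

Lemma card_porbits_cycle m c s : (0 < m)%N -> single_cycle m.+1 c ->
  (#|porbits s| <= #|porbits (c * s)%g| + m)%N.
Proof.
move=> m0 /existsP[x /andP[/eqP Ec /forallP cfix]].
have {}cfix z : z \notin porbit c x -> c z = z.
  by move=> zx; apply/eqP; have := cfix z; rewrite zx.
have := card_porbits_star x (traject c (c x) m) s.
by move: (traject_star cfix); rewrite Ec size_traject /= => <-.
Qed.

Lemma porbit1 x : porbit (1 : {perm T})%g x = [set x].
Proof.
apply/eqP; rewrite eqEsubset sub1set porbit_id andbT.
by apply: porbit_closed => [y|]; rewrite ?perm1 ?set11.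
Qed.

Lemma card_porbits1 : #|porbits (1 : {perm T})%g| = #|T|.
Proof.
apply/eqP; rewrite -(eqr_nat rat) -sum_inv_card_porbit.
under eq_bigr => x _ do rewrite porbit1 cards1 invr1.
by rewrite sumr_const.
Qed.

Lemma orbit_weight1 : orbit_weight (1 : {perm T})%g = 1.
Proof.
by rewrite /orbit_weight big1 // => _ /imsetP[x _ ->]; rewrite porbit1 cards1.
Qed.

Lemma card_porbits_prod m (t : seq {perm T}) : (0 < m)%N ->
  all (single_cycle m.+1) t ->
  (#|T| <= #|porbits (\prod_(c <- t) c)%g| + size t * m)%N.
Proof.
move=> m0; elim: t => [_|c t IHt /= /andP[Hc Ht]].
  by rewrite big_nil card_porbits1 addn0.
rewrite big_cons (leq_trans (IHt Ht)) // mulSn addnA leq_add2r.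
exact: card_porbits_cycle.
Qed.

(** The number of orbits starts at n = #|T| and drops by m at each cycle, so the
falling factorials given by [sum_cycle_weight] fit together. *)
Lemma sum_factorisation_weight m j : (0 < m)%N ->
  \sum_(t : j.-tuple {perm T} | all (single_cycle m.+1) t &&
       (#|porbits (\prod_(c <- t) c)%g| + j * m == #|T|)%N)
     orbit_weight (\prod_(c <- t) c)%g =
  #|T|%:R ^+ j * falling (#|T|%:R - 1) (j * m).
Proof.
move=> m0; elim: j => [|j IHj].
  rewrite /falling big_ord0 mul1r (big_pred1 [tuple]) => [|t].
    by rewrite big_nil orbit_weight1.
  by rewrite (tuple0 t) /= big_nil card_porbits1 addn0 !eqxx.
rewrite big_tuple_cons.
(* Both lower bounds on the number of orbits must be attained: by the tail t of
   the tuple (Q) and by its head c (R). *)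
pose Q (t : j.-tuple {perm T}) := all (single_cycle m.+1) t &&
       (#|porbits (\prod_(c <- t) c)%g| + j * m == #|T|)%N.
pose R c (t : j.-tuple {perm T}) := single_cycle m.+1 c &&
  (#|porbits (c * \prod_(b <- t) b)%g| + m == #|porbits (\prod_(b <- t) b)%g|)%N.
have PE c (t : j.-tuple {perm T}) :
   all (single_cycle m.+1) (cons_tuple c t) &&
    (#|porbits (\prod_(b <- cons_tuple c t) b)%g| + j.+1 * m == #|T|)%N
    = Q t && R c t.
  rewrite /Q /R /= big_cons; case Hc: (single_cycle _ c); last by rewrite andbF.
  case Ht: (all _ t) => //=.
  have := card_porbits_prod m0 Ht; rewrite size_tuple.
  have := card_porbits_cycle (\prod_(b <- t) b)%g m0 Hc.
  move: #|_| #|porbits (\prod_(b <- t) b)%g| #|T| => a b d.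
  by rewrite mulSn => *; apply/eqP/andP => [?|[/eqP ? /eqP ?]]; [split; apply/eqP|]; lia.
rewrite (exchange_big_dep Q) => [|c t _]; last by rewrite PE => /andP[].
have fallingD : falling (#|T|%:R - 1) (j.+1 * m) = falling (#|T|%:R - 1) (j * m) *
    \prod_(i < m) (#|T|%:R - 1 - (j * m + i)%:R).
  by rewrite mulSn addnC /falling big_split_ord.
transitivity (\sum_(t | Q t) #|T|%:R * \prod_(i < m) (#|T|%:R - 1 - (j * m + i)%:R)
                 * orbit_weight (\prod_(c <- t) c)%g); last first.
  by rewrite -mulr_sumr IHj fallingD exprS; ring.
apply: eq_bigr => t Qt.
rewrite (eq_bigl (fun c => R c t)) => [|c]; last by rewrite [LHS]PE Qt.
under eq_bigr => c _ do rewrite big_cons.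
rewrite sum_cycle_weight //; congr (_ * _ * _); apply: eq_bigr => i _.
by case/andP: Qt => _ /eqP <-; rewrite !natrD; ring.
Qed.
End Star.

(** * Cycle types of k-cycles and of n-cycles *)

Section CycleType.
Import Order.TTheory GRing.Theory Num.Theory.
Local Open Scope nat_scope.
Variable n : nat.
Implicit Types (s p q g : 'S_n) (x y z : 'I_n).

Definition orbit_sizes s : seq nat :=
  [seq #|pred_of_set B| | B <- enum (porbits s)].

Lemma sumn_orbit_sizes s : sumn (orbit_sizes s) = n.
Proof. by rewrite sumnE big_map big_enum sum_card_porbits card_ord. Qed.

Lemma cycle_type_eq s al : sorted geq al ->
  (cycle_type s == al) = perm_eq (orbit_sizes s) al.
Proof.
move=> al_sorted.
have geq_total : total geq by move=> a b; apply: leq_total.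
have geq_trans : transitive geq by move=> a b c; rewrite /= => ba cb; apply: leq_trans cb ba.
have geq_anti : antisymmetric geq by move=> a b; rewrite /= andbC; apply: anti_leq.
rewrite /cycle_type -{1}(sorted_sort geq_trans al_sorted).
by apply/eqP/idP => /(perm_sortP geq_total geq_trans geq_anti).
Qed.

(** Isolates the orbit of x in the multiset of orbit sizes; the remaining sizes
are then compared with a list of ones. *)
Lemma perm_orbit_sizes s x : perm_eq (orbit_sizes s)
  (#|porbit s x| :: [seq #|pred_of_set B| | B <- rem (porbit s x) (enum (porbits s))]).
Proof.
by apply: (perm_map (fun B => #|pred_of_set B|)) (perm_to_rem _); rewrite mem_enum imset_f.
Qed.

Lemma mem_rem_porbits s x (B : {set 'I_n}) :
  B \in rem (porbit s x) (enum (porbits s)) = (B != porbit s x) && (B \in porbits s).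
Proof. by rewrite mem_rem_uniq ?enum_uniq // !inE mem_enum. Qed.

Lemma is_kcycleE k s : 1 < k -> is_kcycle k s = single_cycle k s.
Proof.
move=> k1; rewrite /is_kcycle cycle_type_eq; last first.
  by case: (n - k) => //= d; rewrite (ltnW k1); elim: d.
apply/idP/existsP => [Es | [x /andP[/eqP Ex /forallP sfix]]].
  have : k \in orbit_sizes s by rewrite (perm_mem Es) mem_head.
  case/mapP => _ /[!mem_enum] /imsetP[x _ ->] Ek; exists x; rewrite -Ek eqxx.
  apply/forallP => z; apply/implyP => zx.
  have := perm_orbit_sizes s x; rewrite (permPl Es) -Ek perm_cons => /perm_mem sz1.
  have := sz1 #|porbit s z|; rewrite map_f; last first.
    by rewrite mem_rem_porbits eq_porbit_mem zx imset_f.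
  rewrite mem_nseq => /andP[_ /eqP /eqP/cards1P[a Ea]].
  have := porbit_id s z; have := mem_porbit s 1 z.
  by rewrite Ea !inE expg1 => /eqP-> /eqP<-.
have := perm_orbit_sizes s x; set r := [seq _ | _ <- _] => Er.
have r1 : r = nseq (size r) 1.
  apply/all_pred1P/allP => _ /mapP[B] /[!mem_rem_porbits] /andP[nB] /imsetP[z _ EB] ->.
  rewrite EB eq_porbit_mem in nB *; apply/cards1P; exists z.
  apply/eqP; rewrite eqEsubset sub1set porbit_id andbT.
  apply: porbit_closed => [y|]; rewrite !inE // => /eqP->.
  by have := sfix z; rewrite nB.
rewrite (permPl Er) Ex r1; have := perm_sumn Er.
by rewrite sumn_orbit_sizes Ex /= {1}r1 sumn_nseq mul1n => ->; rewrite addKn.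
Qed.

Lemma cycle_type_full s : 0 < n ->
  (cycle_type s == [:: n]) = (#|porbits s| == 1).
Proof.
move=> n0; rewrite cycle_type_eq //.
have sz : size (orbit_sizes s) = #|porbits s| by rewrite size_map -cardE.
apply/idP/eqP => [/perm_size | c1]; first by rewrite sz.
have := sumn_orbit_sizes s; move: sz; rewrite c1.
by case: orbit_sizes => [|a [|]] //= _; rewrite addn0 => ->.
Qed.

End CycleType.

(** * Conjugacy of full cycles *)

Section Conj.
Import Order.TTheory GRing.Theory Num.Theory.
Local Open Scope nat_scope.
Variable T : finType.
Implicit Types (s p q g : {perm T}) (x y z : T).

Lemma porbit_full s x : #|porbits s| = 1 -> porbit s x = [set: T].
Proof.
move/eqP/cards1P=> [B EB]; apply/setP => z; rewrite in_setT -eq_porbit_mem; apply/eqP.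
have inB y : porbit s y = B by apply/set1P; rewrite -EB imset_f.
by rewrite !inB.
Qed.

Lemma starJ x l g : (star x l ^ g)%g = star (g x) (map g l).
Proof. by elim: l => [|y l IHl]; rewrite /= ?conj1g // conjMg tpermJ IHl. Qed.

Lemma single_cycle_star k s : single_cycle k s ->
  exists x l, [/\ uniq (x :: l), (size l).+1 = k & s = star x l].
Proof.
case/existsP => x /andP[/eqP Ek /forallP sfix].
have {}sfix z : z \notin porbit s x -> s z = z.
  by move=> zx; apply/eqP; have := sfix z; rewrite zx.
exists x, (traject s (s x) #|porbit s x|.-1); rewrite -traject_star //; split=> //.
  have := uniq_traject_porbit s x.
  by case: #|porbit s x| (card_porbit_neq0 s x).
by rewrite size_traject prednK // lt0n card_porbit_neq0.
Qed.

Lemma single_cycleJ k s g : single_cycle k s -> single_cycle k (s ^ g)%g.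
Proof.
case/single_cycle_star => x [l [Ul <- ->]]; rewrite starJ -(size_map g).
by apply: star_single_cycle; rewrite -map_cons map_inj_uniq //; apply: perm_inj.
Qed.

Lemma single_cycle_full s (x : T) : #|porbits s| = 1 -> single_cycle #|T| s.
Proof.
move=> c1; apply/existsP; exists x; rewrite porbit_full // cardsT eqxx /=.
by apply/forallP => z; rewrite in_setT.
Qed.

(** Both permutations run through all of T; the conjugating permutation matches the
two enumerations. *)
Lemma full_cycle_conj p q : 0 < #|T| -> #|porbits p| = 1 -> #|porbits q| = 1 ->
  exists g, q = (p ^ g)%g.
Proof.
case/card_gt0P => x0 _ /(single_cycle_full x0)/single_cycle_star[x [l [Ul sl ->]]].
move=> /(single_cycle_full x0)/single_cycle_star[x' [l' [Ul' sl' ->]]].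
have mem_l y : y \in x :: l.
  have card_l : #|x :: l| = #|T| by rewrite (card_uniqP Ul).
  by rewrite (subset_cardP card_l (subset_predT _)).
have size_ll' : size (x :: l) = size (x' :: l') by rewrite /= sl sl'.
have g_inj : injective (fun y => nth x' (x' :: l') (index y (x :: l))).
  move=> y z /eqP; rewrite nth_uniq -?size_ll' ?index_mem //.
  by move/eqP/(congr1 (nth x (x :: l))); rewrite !nth_index.
exists (perm g_inj); rewrite starJ permE index_head; congr (star _ _).
suff [] : x' :: l' = map (perm g_inj) (x :: l) by [].
apply: (@eq_from_nth _ x'); rewrite ?size_map // => i.
rewrite -size_ll' => Hi; rewrite (nth_map x) // permE index_uniq //.
Qed.

(** The group contains p, whose powers already reach every point. *)
Lemma prod_full_transitive (t : seq {perm T}) p (x : T) : #|porbits p| = 1 ->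
  (\prod_(c <- t) c)%g = p -> [transitive <<[set c in t]>>%g, on [set: T] | 'P].
Proof.
move=> p1 Ep; apply/imsetP; exists x; rewrite ?in_setT //.
apply/esym/eqP; rewrite eqEsubset subsetT -(porbit_full x p1) /=.
apply/subsetP => _ /porbitP[i ->].
have -> : (p ^+ i)%g x = ('P%act x (p ^+ i)%g) by [].
apply: mem_orbit; apply: groupX; rewrite -Ep big_seq; apply: group_prod => c ct.
by apply: mem_gen; rewrite inE.
Qed.
End Conj.

(** * The number of minimal factorisations of a full cycle *)

Section Count.
Import Order.TTheory GRing.Theory Num.Theory.
Local Open Scope nat_scope.

Lemma transitive_factorisation_full n k j (p : 'S_n) (t : j.-tuple 'S_n) :
  0 < n -> 1 < k -> #|porbits p| = 1 ->
  transitive_factorisation k p t =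
  all (@single_cycle 'I_n k) t && ((\prod_(s <- t) s)%g == p).
Proof.
move=> n0 k1 p1; rewrite /transitive_factorisation.
rewrite (eq_all (fun s => is_kcycleE s k1)); congr (_ && _).
case: eqP => //= Ep; exact: prod_full_transitive (Ordinal n0) p1 Ep.
Qed.

(** Conjugation by a fixed permutation sends the factorisations of p injectively to
those of q. *)
Lemma num_min_fact_le n k al (p q : 'S_n) : 0 < n -> 1 < k ->
  #|porbits p| = 1 -> #|porbits q| = 1 ->
  num_min_fact k al p <= num_min_fact k al q.
Proof.
move=> n0 k1 p1 q1; have [|g Eq] := full_cycle_conj _ p1 q1; first by rewrite card_ord.
rewrite /num_min_fact -(card_imset _ (_ : injective (map_tuple (fun s => s ^ g)%g))).
  apply: subset_leq_card; apply/subsetP => _ /imsetP[t + ->].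
  rewrite !inE !transitive_factorisation_full // => /andP[Ht /eqP Ep].
  rewrite all_map (sub_all _ Ht) => [|s]; last exact: single_cycleJ.
  rewrite big_map Eq -Ep; apply/eqP/esym; apply: (big_morph (fun s => s ^ g)%g).
    by move=> a b; apply: conjMg.
  exact: conj1g.
move=> t1 t2 /(congr1 val) /= /inj_map E; apply/val_inj/E.
exact: conjg_inj.
Qed.

(** Replaces the type of permutations of [sumn al] points, which does not reduce for
al = [:: n], by that of permutations of n points. *)
Lemma ckE k al n : sumn al = n ->
  ck k al = if [pick p in @conj_class n al] is Some p
            then num_min_fact k al p else 0.
Proof. by move<-. Qed.

(** The number of factorisations is the same for all full cycles, so its product
with the size of the class counts the tuples of k-cycles whose product is any
full cycle. *)
Lemma ck_full_cycle n k : 0 < n -> 1 < k ->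
  ck k [:: n] * #|@conj_class n [:: n]| =
  #|[set t : (muk k [:: n]).-tuple 'S_n |
      all (@single_cycle 'I_n k) t && (#|porbits (\prod_(s <- t) s)%g| == 1)]|.
Proof.
move=> n0 k1; rewrite (ckE _ (addn0 n : sumn [:: n] = n)).
have inC (p : 'S_n) : (p \in conj_class n [:: n]) = (#|porbits p| == 1).
  by rewrite inE cycle_type_full.
rewrite -[RHS]sum1_card (partition_big (fun t : _.-tuple 'S_n => \prod_(s <- t) s)%g
  (mem (@conj_class n [:: n]))) /=; last first.
  by move=> t; rewrite inE inC => /andP[].
have num_p p : p \in conj_class n [:: n] ->
    \sum_(t | (t \in [set t : (muk k [:: n]).-tuple 'S_n | all (@single_cycle 'I_n k) t &&
       (#|porbits (\prod_(s <- t) s)%g| == 1)]) && ((\prod_(s <- t) s)%g == p)) 1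
    = num_min_fact k [:: n] p.
  move=> pC; rewrite /num_min_fact -sum1_card; apply: eq_bigl => t.
  rewrite inC in pC; rewrite !inE transitive_factorisation_full //; last exact/eqP.
  by rewrite -andbA; case: (_ =P p) => [->|_]; rewrite ?andbF // pC.
rewrite (eq_bigr _ num_p); case: pickP => [p0 p0C | C0]; last first.
  by rewrite mul0n big_pred0.
rewrite mulnC -sum_nat_const; apply: eq_bigr => p pC.
rewrite !inC in p0C pC; move/eqP: p0C => p0C; move/eqP: pC => pC.
by apply/eqP; rewrite eqn_leq !num_min_fact_le.
Qed.

Lemma falling_fact n : (falling n%:R n = n`!%:R)%R.
Proof.
rewrite -ffactnn ffact_prod natr_prod; apply: eq_bigr => i _.
by rewrite natrB // ltnW.
Qed.

(** A full cycle has weight n, and products of j k-cycles with j (k-1) = n-1 reach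
one orbit exactly when every cycle merges as much as it can, so
[sum_factorisation_weight] counts them. With |C_[n]| = (n-1)! this is the
formula c_k([n]) = n^(j-1). *)
Lemma count_full_cycle n k : 0 < n -> 1 < k -> k - 1 %| n - 1 ->
  (n%:R * (ck k [:: n] * #|@conj_class n [:: n]|)%:R =
   n%:R ^+ muk k [:: n] * (n.-1)`!%:R :> rat)%R.
Proof.
move=> n0 k1 kn; rewrite ck_full_cycle //; set j := muk _ _.
have jE : j * (k - 1) = n.-1.
  rewrite /j /muk /= addn0 addn1 subSS subn1 -subn1.
  by rewrite divnK.
have k1E : (k - 1).+1 = k by rewrite subn1 prednK // ltnW.
have m0 : 0 < k - 1 by rewrite subn_gt0.
have := @sum_factorisation_weight 'I_n _ j m0.
rewrite card_ord jE k1E (_ : (n%:R - 1 = n.-1%:R)%R) ?falling_fact; last first.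
  by rewrite -subn1 natrB.
move=> <-.
rewrite -sum1_card natr_sum mulr_sumr; apply: eq_big => [t|t].
  by rewrite inE; congr (_ && _); rewrite -(eqn_add2r n.-1) add1n prednK.
rewrite inE => /andP[_ /cards1P[B EB]]; rewrite mulr1 /orbit_weight EB big_set1.
by rewrite -{1}(card_ord n) -(sum_card_porbits (\prod_(s <- t) s)%g) EB big_set1.
Qed.
End Count.

(** * The coefficients of the generating series *)

Section Coef.
Import Order.TTheory GRing.Theory Num.Theory.
Local Open Scope ring_scope.

Lemma psi_monomial1 (t : monomial) n :
  psi_monomial t [tuple n] = (nth 0%N t.1.1 0 == n)%:R.
Proof.
rewrite /psi_monomial (eq_bigr (fun=> (nth 0%N t.1.1 0 == n)%:R)) => [|s _].
  by rewrite sumr_const card_Sn mulr1n.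
congr (_%:R); rewrite -val_eqE /= enum_ordSl enum_ord0 /= ord1 eqseq_cons eq_sym andbT.
by [].
Qed.

Lemma Pk1E k n : Pk1 k n = Fk k 1 ([:: n], muk k [:: n], n).
Proof.
(* Only one monomial contributes: a one-part partition of n is [:: n]. *)
pose t0 : monomial := ([:: n], muk k [:: n], n).
rewrite /Pk1 /Pk /psi -(fsbig_widen (classical_sets.set1 t0)) //.
  by rewrite fsbig_set1 psi_monomial1 eqxx mulr1.
move=> [[al i] j] [_ /= ne]; rewrite psi_monomial1 /=.
case: ifP => [/and5P[_ /eqP sal /eqP sj _ /andP[_ /eqP Ei]]|]; last by rewrite mul0r.
case: eqP => [al0|]; last by rewrite mulr0.
case: ne; rewrite /t0 Ei -sj; case: al sal al0 {Ei sj} => [|a []] //= _ ->.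
by rewrite addn0.
Qed.

Lemma euler2_Pk1 k n : (1 < k)%N ->
  euler (euler (Pk1 k)) n =
  if (0 < n)%N && (k.-1 %| n.-1)%N
  then n%:R ^+ (n.-1 %/ k.-1) / ((n.-1 %/ k.-1)`!)%:R else 0.
Proof.
move=> k1; rewrite !eulerE Pk1E /Fk /is_partition /= addn0 !eqxx !andbT.
rewrite addn1 subSS !subn1; case: n => [|n] /=; first by rewrite mul0r.
case: ifP => kn; last by rewrite !mulr0.
have := @count_full_cycle n.+1 k isT k1; rewrite !subn1 => /(_ kn) /=.
rewrite natrM /muk /= addn0 addn1 subSS !subn1 /= => E.
have nz1 : n.+1%:R != 0 :> rat by rewrite pnatr_eq0.
have nz2 a : a`!%:R != 0 :> rat by rewrite pnatr_eq0 -lt0n fact_gt0.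
rewrite factS natrM [X in X / _ / _](_ : _ = n.+1%:R ^+ (n %/ k.-1) * n`!%:R / n.+1%:R).
  move: (nz2 n) (nz2 (n %/ k.-1)%N) nz1.
  move: (n`!%:R : rat) ((n %/ k.-1)`!%:R : rat) (n.+1%:R : rat) => a b c a0 b0 c0.
  by field; do ?[apply/andP; split].
by apply: (mulfI nz1); rewrite E mulrCA divff ?mulr1.
Qed.
End Coef.

Theorem theorem1p3 (k : nat) (hk : 2 <= k) :
  exists w : fps,
    unique (is_w k) w /\
    unique
      (fun S : fps =>
         euler (euler (Pk1 k)) = fps_mul (fps_comp S w) (euler w))
      fps_one.
Proof.
case: k hk => [|[|m]] // _; have [w Hw] := is_w_exists m.+2.
have w0 := is_w_coef0 Hw; have w1 := is_w_coef1 Hw.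
have main : euler (euler (Pk1 m.+2)) = fps_mul (fps_comp fps_one w) (euler w).
  rewrite fps_comp_one fps_mul1; apply/funext => n.
  by rewrite euler2_Pk1 // (euler_w_coef _ Hw).
exists w; split; split=> //; first by move=> w'; apply: is_w_unique.
move=> S; rewrite main => /fps_mul_order1_inj E; apply: (fps_comp_order1_inj w0 w1).
by apply: E; rewrite eulerE ?w0 ?w1 ?GRing.mulr0 ?GRing.mulr1.
Qed.
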